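(* Let $q$ be an odd prime power and let $p_{i,j}^k$ be the intersection numbers of the planar Euclidean association scheme on $\mathbb{F}_q^2$, for $i,j,k\in\Delta\cap\mathbb{F}_q$ (that is, $i,j,k$ are distances in $\mathbb{F}_q$ not equal to $\bar 0$). If $q\equiv 1 \pmod 4$, then $p_{i,j}^0=1+(q-2)\delta_{i,j}\delta_{i,0}-\delta_{i,j}$. Otherwise $k\neq 0$, and $$p_{i,j}^k=\binom{4\sigma_2-\sigma_1^2}{q}+1,$$ where $\sigma_1=i+j+k$ and $\sigma_2=ij+jk+ki$. Furthermore, when $i,j,k\in\mathbb{F}_q$ are the distances in a triple of points of $\mathbb{F}_q^2$, we have $4\sigma_2=\sigma_1^2$ if and only if $\{i,j,k\}$ are the distances of a collinear triple of points (a triple of points that lies on an affine line).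
   Context: For $v=(v_1,v_2)\in\mathbb{F}_q^2$ let $Q(v)=v_1^2+v_2^2$. The planar Euclidean association scheme is the set $\mathbb{F}_q^2$ with the symmetric ''distance'' function $d(x,y)=\bar 0$ if $x=y$ and $d(x,y)=Q(x-y)\in\mathbb{F}_q$ if $x\neq y$, where $\bar 0$ is a formal symbol distinct from $0\in\mathbb{F}_q$. The distance set is $\Delta=\mathbb{F}_q\cup\{\bar 0\}$ if $q\equiv 1\pmod 4$ and $\Delta=\mathbb{F}_q^\times\cup\{\bar 0\}$ if $q\equiv 3\pmod 4$ (in which case $Q(v)=0$ only for $v=0$). For $i,j,k\in\Delta$, the intersection number $p_{i,j}^k$ is the number of $z\in\mathbb{F}_q^2$ with $d(x,z)=i$ and $d(z,y)=j$, where $x,y$ is any pair with $d(x,y)=k$ (this number does not depend on the choice of the pair). Here $\delta$ is the Kronecker delta, and $\binom{x}{q}$ is the Legendre symbol (quadratic character) of $\mathbb{F}_q$: $+1$ if $x$ is a nonzero square, $-1$ if $x$ is a nonsquare, and $0$ if $x=0$.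
   Formalization: For q≡1 (mod 4) and k≠0 the formula is stated only when {i,j}≠{0,k}: if {i,j}={0,k} it would give 1, but p_{i,j}^k=0 (e.g. q=5, i=0, j=k=1), since the only candidate point coincides with x or y, at distance \bar 0 rather than 0. *)

(* Defs.v *)
From mathcomp Require Import all_boot all_order all_algebra all_field.
From mathcomp Require Import ring.

Set Implicit Arguments.
Unset Strict Implicit.
Unset Printing Implicit Defensive.

Import Order.TTheory GRing.Theory Num.Theory.

Local Open Scope ring_scope.

Section EuclideanScheme.

Variable F : finFieldType.

Implicit Types (u v x y z : 'rV[F]_2) (i j k : option F).

Definition Q v : F := v 0 0 ^+ 2 + v 0 1 ^+ 2.

(* Distances live in [option F]: [None] is the formal symbol for the distance
   of a point to itself, distinct from the field element [Some 0]. *)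
Definition dist x y : option F := if x == y then None else Some (Q (x - y)).

Definition Delta : {set option F} :=
  if (#|F| %% 4 == 1)%N then [set: option F] else [set~ Some 0].

Definition pair_number i j x y : nat :=
  #|[set z | (dist x z == i) && (dist z y == j)]|.

(* The pair at distance [k] is an arbitrary one; the value does not depend on
   it, see [intersection_numberE]. The value 0 is a dummy for [k] outside the
   distance set. *)
Definition intersection_number i j k : nat :=
  if [pick a : 'rV[F]_2 * 'rV[F]_2 | dist a.1 a.2 == k] is Some a
  then pair_number i j a.1 a.2 else 0%N.

Definition quad_char (a : F) : int :=
  if a == 0 then 0 else if [exists b : F, b ^+ 2 == a] then 1 else -1.

Definition affine_line (p v : 'rV[F]_2) : {set 'rV[F]_2} :=
  [set p + t *: v | t : F].

Definition collinear x y z : Prop :=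
  exists p v, v != 0 /\ [set x; y; z] \subset affine_line p v.

Definition triple_distances x y z (i j k : F) : Prop :=
  [/\ dist x z = Some i, dist z y = Some j & dist x y = Some k].

Definition vec2 (a b : F) : 'rV[F]_2 := \row_c (if c == 0 then a else b).

Lemma vec2_0 a b : vec2 a b 0 0 = a.
Proof. by rewrite mxE. Qed.

Lemma vec2_1 a b : vec2 a b 0 1 = b.
Proof. by rewrite mxE. Qed.

Lemma vec2P u v : u 0 0 = v 0 0 -> u 0 1 = v 0 1 -> u = v.
Proof.
move=> e0 e1; apply/rowP => c; have [->//|c0] := eqVneq c 0.
suff -> : c = 1 by [].
by apply/val_inj; move: c c0 => [[|[|c]] hc].
Qed.

Definition lin2 (a b c d : F) v : 'rV[F]_2 :=
  vec2 (a * v 0 0 + b * v 0 1) (c * v 0 0 + d * v 0 1).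

Definition isometry2 (g : 'rV[F]_2 -> 'rV[F]_2) : Prop :=
  [/\ {morph g : u v / u - v}, injective g & forall v, Q (g v) = Q v].

Lemma isometry_rot a b : a ^+ 2 + b ^+ 2 = 1 -> isometry2 (lin2 a (- b) b a).
Proof.
move=> e; split.
- by move=> u v; apply: vec2P; rewrite !(vec2_0, vec2_1, mxE) /=; ring.
- apply: (can_inj (g := lin2 a b (- b) a)) => v.
  apply: vec2P; rewrite !(vec2_0, vec2_1).
    by rewrite -[RHS]mul1r -e; ring.
  by rewrite -[RHS]mul1r -e; ring.
- move=> v; rewrite /Q !(vec2_0, vec2_1) -[RHS]mul1r -e; ring.
Qed.

Lemma isometry_refl : isometry2 (lin2 1 0 0 (-1)).
Proof.
split.
- by move=> u v; apply: vec2P; rewrite !(vec2_0, vec2_1, mxE) /=; ring.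
- apply: (can_inj (g := lin2 1 0 0 (-1))) => v.
  by apply: vec2P; rewrite !(vec2_0, vec2_1); ring.
- by move=> v; rewrite /Q !(vec2_0, vec2_1); ring.
Qed.

Lemma isometry_comp g h : isometry2 g -> isometry2 h -> isometry2 (g \o h).
Proof.
move=> [gB gi gQ] [hB hi hQ]; split.
- by move=> u v /=; rewrite hB gB.
- exact: inj_comp.
- by move=> v /=; rewrite gQ hQ.
Qed.

Lemma two_neq0 : odd #|F| -> (2 : F) != 0.
Proof.
move=> oddF; apply/negP => c2.
have ch2 : 2 \in [pchar F] by rewrite inE.
have [n cF] : exists n, #|F| = (2 ^ n)%N.
  by eexists; exact: card_pprimeChar ch2.
have := finNzRing_gt1 F; move: oddF; rewrite cF.
by case: n {cF} => [|n]; rewrite ?expn0 // expnS oddM.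
Qed.

Lemma isometry_trans u v : odd #|F| -> u != 0 -> v != 0 -> Q u = Q v ->
  exists2 g, isometry2 g & g u = v.
Proof.
move=> oddF u0 v0 eQ; have two0 := two_neq0 oddF.
have nz w : w != 0 -> Q w = 0 -> w 0 0 != 0.
  move=> w0 Qw; apply: contra_neq w0 => a0.
  move/eqP: Qw; rewrite /Q a0 expr0n add0r sqrf_eq0 => /eqP b0.
  by apply: vec2P; rewrite ?a0 ?b0 mxE.
have [Qu0|Qu0] := eqVneq (Q u) 0; last first.
  set a := (v 0 0 * u 0 0 + v 0 1 * u 0 1) / Q u.
  set b := (v 0 1 * u 0 0 - v 0 0 * u 0 1) / Q u.
  exists (lin2 a (- b) b a).
    apply: isometry_rot.
    have -> : a ^+ 2 + b ^+ 2 = Q v * Q u / Q u ^+ 2.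
      by rewrite /a /b /Q; field.
    by rewrite -eQ -expr2 divff // expf_neq0.
  by apply: vec2P; rewrite !(vec2_0, vec2_1) /a /b; move: Qu0; rewrite /Q => ?;
    field.
have Qv0 : Q v = 0 by rewrite -eQ.
have {u0} a0 := nz _ u0 Qu0; have {v0} b0 := nz _ v0 Qv0.
pose r := u 0 1 / u 0 0.
have r2 : r ^+ 2 = -1.
  apply/eqP; rewrite -subr_eq0 opprK; apply/eqP.
  transitivity (Q u / u 0 0 ^+ 2); first by rewrite /r /Q; field.
  by rewrite Qu0 mul0r.
have u1 : u 0 1 = r * u 0 0 by rewrite /r; field.
wlog v1 : v b0 eQ Qv0 / v 0 1 = r * v 0 0.
  move=> W; have [|v1] := eqVneq (v 0 1) (r * v 0 0); first exact: W.
  pose h := lin2 1 0 0 (-1).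
  have [hB hi hQ] := isometry_refl.
  have [||||g ig gu] := W (h v).
  - by rewrite vec2_0 mul1r mul0r addr0.
  - by rewrite hQ.
  - by rewrite hQ.
  - rewrite vec2_0 vec2_1 mul1r !mul0r addr0 add0r mulN1r.
    have /eqP : (v 0 1 - r * v 0 0) * (v 0 1 + r * v 0 0) = 0.
      transitivity (v 0 1 ^+ 2 - r ^+ 2 * v 0 0 ^+ 2); first by ring.
      by rewrite r2 mulN1r opprK addrC.
    rewrite mulf_eq0 subr_eq0 (negPf v1) addr_eq0 => /eqP ->.
    by rewrite opprK.
  exists (h \o g); first exact: isometry_comp isometry_refl ig.
  by rewrite /= gu; apply: vec2P; rewrite !(vec2_0, vec2_1); ring.
pose t := v 0 0 / u 0 0.
have t0 : t != 0 by rewrite mulf_neq0 ?invr_neq0.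
have vt : v 0 0 = t * u 0 0 by rewrite /t; field.
exists (lin2 ((t + t^-1) / 2) (- (r * (t - t^-1) / 2))
             (r * (t - t^-1) / 2) ((t + t^-1) / 2)).
  apply: isometry_rot.
  transitivity (((t + t^-1) / 2) ^+ 2 + r ^+ 2 * ((t - t^-1) / 2) ^+ 2).
    by ring.
  by rewrite r2; field; rewrite ?t0 ?two0.
apply: vec2P; rewrite !(vec2_0, vec2_1).
  transitivity ((t + t^-1) / 2 * u 0 0 - r ^+ 2 * ((t - t^-1) / 2 * u 0 0)).
    by rewrite u1; ring.
  by rewrite r2 vt; field; rewrite ?t0 ?two0.
by rewrite v1 u1 vt; field; rewrite ?t0 ?two0.
Qed.

Lemma dist_isometry g p q x y : isometry2 g ->
  dist (g (x - p) + q) (g (y - p) + q) = dist x y.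
Proof.
move=> [gB gi gQ]; rewrite /dist (inj_eq (addIr q)) (inj_eq gi).
rewrite (inj_eq (addIr _)); case: eqP => // _.
have E (a b c : 'rV[F]_2) : a + c - (b + c) = a - b.
  by rewrite opprD addrACA subrr addr0.
by rewrite E -gB gQ E.
Qed.

Lemma pair_number_indep i j x y x' y' : odd #|F| ->
  dist x y = dist x' y' -> pair_number i j x y = pair_number i j x' y'.
Proof.
move=> oddF exy.
have [g ig gxy] : exists2 g, isometry2 g & g (y - x) = y' - x'.
  move: exy; rewrite /dist; case: (eqVneq x y) => [->|nxy].
    case: eqP => // -> _; exists (lin2 1 (- 0) 0 1).
      by apply: isometry_rot; ring.
    by rewrite !subrr; apply: vec2P; rewrite !(vec2_0, vec2_1, mxE); ring.
  case: eqVneq => // nxy' [eQ]; apply: isometry_trans => //.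
  - by rewrite subr_eq0 eq_sym.
  - by rewrite subr_eq0 eq_sym.
  - have QN v : Q (- v) = Q v by rewrite /Q !mxE !sqrrN.
    by rewrite -opprB QN eQ -QN opprB.
have [gB gi gQ] := ig.
pose f z := g (z - x) + x'.
have fi : injective f by move=> z w /addIr /gi /addIr.
have g0 : g 0 = 0 by rewrite -[X in g X](subrr 0) gB subrr.
have fx : f x = x' by rewrite /f subrr g0 add0r.
have fy : f y = y' by rewrite /f gxy subrK.
rewrite /pair_number -(card_imset _ fi); apply: eq_card => w.
have [f' fK f'K] := injF_bij fi.
rewrite -[w]f'K (mem_imset _ _ fi) !inE -[in RHS]fx -[in RHS]fy.
by rewrite /f !(dist_isometry x x').
Qed.

Lemma intersection_numberE i j x y : odd #|F| ->
  intersection_number i j (dist x y) = pair_number i j x y.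
Proof.
move=> oddF; rewrite /intersection_number; case: pickP => [a /eqP e|/(_ (x, y))].
  exact: pair_number_indep.
by rewrite eqxx.
Qed.

End EuclideanScheme.

(* Main.v *)
Require Import Defs.
From mathcomp Require Import all_boot all_order all_algebra.
From mathcomp Require Import all_field ring.

(** The heart is Heron's identity: if [i], [j], [k] are the values of [Q] on the
    sides of a triangle, then [4 * sigma2 - sigma1 ^ 2] is the square of twice
    the determinant of two of its sides.  It vanishes iff the points are
    collinear.  For [k <> 0] a point [z] is determined by its inner product and
    its determinant with [x - y]; the former is fixed by the distances, and
    Heron's identity leaves for the latter exactly the square roots of
    [4 * sigma2 - sigma1 ^ 2].  For [k = 0] the points [x] and [y] lie on an
    isotropic line, and [Q] factors into two linear forms. *)

Import Order.TTheory GRing.Theory Num.Theory.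

Local Open Scope ring_scope.

Section PlanarTriples.

Set Implicit Arguments.
Unset Strict Implicit.

Variable F : finFieldType.

Implicit Types (u v x y z : 'rV[F]_2) (i j k a t : F).

(** * Determinants, Heron's form and square roots *)

Definition cross u v : F := u 0 0 * v 0 1 - u 0 1 * v 0 0.

Definition heron i j k : F :=
  4 * (i * j + j * k + k * i) - (i + j + k) ^+ 2.

Lemma heron_cross x y z :
  heron (Q (x - z)) (Q (z - y)) (Q (x - y)) =
  (2 * cross (x - y) (x - z)) ^+ 2.
Proof. by rewrite /heron /cross /Q !mxE; ring. Qed.

Lemma dist_eqSome x y i : (dist x y == Some i) = (x != y) && (Q (x - y) == i).
Proof. by rewrite /dist; case: (eqVneq x y). Qed.

Lemma Q0 : Q (0 : 'rV[F]_2) = 0.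
Proof. by rewrite /Q !mxE expr0n addr0. Qed.

Lemma QN v : Q (- v) = Q v.
Proof. by rewrite /Q !mxE !sqrrN. Qed.

(** Lets the right-hand side of the formula be read as a number of square roots; [2 != 0] keeps [b]
    and [- b] apart. *)
Lemma quad_char_sqrt a : (2 : F) != 0 ->
  (#|[set t | t ^+ 2 == a]|)%:Z = quad_char a + 1.
Proof.
move=> two0; rewrite /quad_char; have [->|a0] := eqVneq a 0.
  suff -> : [set t : F | t ^+ 2 == 0] = [set 0] by rewrite cards1.
  by apply/setP => t; rewrite !inE sqrf_eq0.
case: existsP => [[b /eqP b2]|nb].
  have b0 : b != 0 by apply: contra_neq a0 => b0; rewrite -b2 b0 expr0n.
  suff -> : [set t | t ^+ 2 == a] = [set b; - b].
    by rewrite cards2 -addr_eq0 -mulr2n -mulr_natl mulf_neq0.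
  by apply/setP => t; rewrite !inE -b2 eqf_sqr.
suff -> : [set t | t ^+ 2 == a] = set0 by rewrite cards0.
by apply/setP => t; rewrite !inE; apply/negP => e; apply: nb; exists t.
Qed.

(** * Pairs at nonzero distance *)

Lemma pair_number_neq0 i j x y : odd #|F| -> Q (x - y) != 0 ->
  [set i; j] != [set 0; Q (x - y)] ->
  (pair_number (Some i) (Some j) x y)%:Z =
  quad_char (heron i j (Q (x - y))) + 1.
Proof.
move=> oddF k0 nd; have two0 := two_neq0 oddF.
rewrite -quad_char_sqrt // /pair_number.
set k := Q (x - y) in k0 nd *; set D := heron _ _ _.
pose S := [set z | (Q (x - z) == i) && (Q (z - y) == j)].
(* The endpoints [z = x] and [z = y] meet the conditions on [Q] only if [i] and [j] are [0] and [k]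
   in some order. Since [nd] excludes this, passing from [dist] to [Q] adds no point. *)
have -> : [set z | (dist x z == Some i) && (dist z y == Some j)] = S.
  apply/setP => z; rewrite !inE !dist_eqSome.
  have [exz|_] := eqVneq x z.
    apply/esym/negP => /andP[/eqP ei /eqP ej]; case/eqP: nd.
    by rewrite -ei -ej -exz subrr Q0.
  have [ezy|//] := eqVneq z y.
  rewrite andbF; apply/esym/negP => /andP[/eqP ei /eqP ej]; case/eqP: nd.
  by rewrite -ei -ej ezy subrr Q0 setUC.
(* [s] and [t / (2 * k)] are the coordinates of [x - z] on [x - y] and on its
   rotation by a right angle. *)
pose f z := 2 * cross (x - y) (x - z).
pose s := (k + i - j) / (2 * k).
pose g t := x - lin2 s (- (t / (2 * k))) (t / (2 * k)) s (x - y).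
have kE : k = (x - y) 0 0 ^+ 2 + (x - y) 0 1 ^+ 2 by [].
have fK : {in S, cancel f g}.
  move=> z; rewrite inE => /andP[/eqP ei /eqP ej].
  have es : s = ((x - y) 0 0 * (x - z) 0 0 + (x - y) 0 1 * (x - z) 0 1) / k.
    rewrite /s -ei -ej.
    have -> : k + Q (x - z) - Q (z - y) =
        2 * ((x - y) 0 0 * (x - z) 0 0 + (x - y) 0 1 * (x - z) 0 1).
      by rewrite /k /Q !mxE; ring.
    by field; rewrite two0 k0.
  apply: (canLR (subKr x)).
  move: k0 es; rewrite /f /cross kE => k0 ->.
  by apply: vec2P; rewrite !(vec2_0, vec2_1); field; rewrite k0 two0.
rewrite -(card_in_imset (can_in_inj fK)); congr Posz; apply: eq_card => t.
rewrite [RHS]inE; apply/imsetP/eqP => [[z]|et].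
  by rewrite inE /D => /andP[/eqP <- /eqP <-] ->; rewrite -heron_cross.
(* This is [D = 4 * i * k - (k + i - j) ^+ 2] divided by [(2 * k) ^+ 2]. *)
have et2 : (t / (2 * k)) ^+ 2 = i / k - s ^+ 2.
  by rewrite expr_div_n et /s /D /heron; field; rewrite two0 k0.
have ei : Q (x - g t) = i.
  rewrite subKr; set w := t / (2 * k).
  transitivity ((s ^+ 2 + w ^+ 2) * k).
    by rewrite kE /Q !(vec2_0, vec2_1); ring.
  by rewrite et2; field.
exists (g t).
  rewrite inE ei eqxx /=; apply/eqP.
  (* Law of cosines; [s] was chosen to make this value [j]. *)
  transitivity (k + Q (x - g t) - 2 * s * k).
    2: by rewrite ei /s; field; rewrite two0 k0.
  have -> : g t - y = (x - y) - (x - g t).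
    by rewrite opprB [RHS]addrC addrA subrK.
  rewrite subKr; set w := lin2 _ _ _ _ _.
  transitivity (k + Q w - 2 * ((x - y) 0 0 * w 0 0 + (x - y) 0 1 * w 0 1)).
    by rewrite /k /Q !mxE; ring.
  by rewrite kE /w !(vec2_0, vec2_1); ring.
rewrite /f subKr /cross !(vec2_0, vec2_1).
transitivity (2 * (t / (2 * k)) * k); first by field; rewrite two0 k0.
by rewrite {2}kE; ring.
Qed.

(** * Isotropic pairs, with [-1] a square *)

Lemma sqrtN1_exists : (#|F| %% 4 = 1)%N -> exists r : F, r ^+ 2 = -1.
Proof.
move=> q1; pose m := (#|F| %/ 4)%N.
have cF : #|F| = (m * 4).+1 by rewrite [LHS](divn_eq _ 4) q1 addn1.
have m0 : (0 < m * 2)%N.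
  by have := finNzRing_gt1 F; rewrite cF muln_gt0 /=; case: (m).
(* The polynomial [X^(2m) - 1] cannot vanish at all [4m] nonzero elements. As [a^(4m) = 1], a
   nonzero [a] that is not a root has [a^(2m) = -1]. *)
have [a] : exists2 a : F, a != 0 & a ^+ (m * 2) != 1.
  case: (pickP [pred a : F | (a != 0) && (a ^+ (m * 2) != 1)]).
    by move=> a /andP[]; exists a.
  move=> h; have := @max_unity_roots _ _ (enum [set~ (0 : F)]) m0.
  rewrite -cardE cardsC1 cF enum_uniq /= => W.
  have : (m * 4 <= m * 2)%N.
    apply: W => //; apply/allP => a; rewrite mem_enum !inE => a0.
    by have := h a; rewrite /= a0 unity_rootE => /negbFE.
  by move: m0; rewrite muln_gt0 andbT => m0; rewrite leq_pmul2l.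
move=> a0 am; exists (a ^+ m); rewrite -exprM.
have : (a ^+ (m * 2)) ^+ 2 == 1 ^+ 2.
  rewrite expr1n -exprM -mulnA; apply/eqP/(mulfI a0).
  by rewrite -exprS -cF expf_card mulr1.
by rewrite eqf_sqr (negPf am) => /eqP.
Qed.

(** The vector [(1, r)] is isotropic. [Q] is the product of the coordinates [z0 + r z1] and
    [z0 - r z1], and subtracting this vector from [z] lowers [Q] by twice the first one. So [i - j]
    fixes the first coordinate, and [i] then fixes the second unless the first is zero. *)
Lemma pair_number_eq0 i j (r : F) : odd #|F| -> r ^+ 2 = -1 ->
  (pair_number (Some i) (Some j) 0 (vec2 1 r))%:Z =
  1 + (#|F|%:Z - 2) * (i == j)%:Z * (i == 0)%:Z - (i == j)%:Z.
Proof.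
move=> oddF r2; have two0 := two_neq0 oddF; rewrite /pair_number.
have r0 : r != 0.
  by apply: contra_eq_neq r2 => ->; rewrite expr0n eq_sym oppr_eq0 oner_eq0.
have Qf z : Q z = (z 0 0 + r * z 0 1) * (z 0 0 - r * z 0 1).
  transitivity (z 0 0 ^+ 2 - r ^+ 2 * z 0 1 ^+ 2); last by ring.
  by rewrite r2 /Q; ring.
have Qy z : Q (z - vec2 1 r) = Q z - 2 * (z 0 0 + r * z 0 1).
  transitivity (Q z - 2 * (z 0 0 + r * z 0 1) + (1 + r ^+ 2)).
    by rewrite /Q !mxE /=; ring.
  by rewrite r2 subrr addr0.
have [<-|nij] := eqVneq i j; last first.
  rewrite !(mulr0, mul0r) addr0 subr0.
  (* The values forced on the two coordinates of [z]. *)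
  pose s := (i - j) / 2; pose s' := i / s.
  have dij : i - j != 0 by rewrite subr_eq0.
  have s0 : s != 0 by rewrite mulf_neq0 ?invr_neq0.
  suff -> : [set z | (dist 0 z == Some i) && (dist z (vec2 1 r) == Some j)] =
      [set vec2 ((s + s') / 2) ((s - s') / (2 * r))] by rewrite cards1.
  apply/setP => z; rewrite !inE !dist_eqSome sub0r QN Qy.
  apply/idP/eqP => [/andP[/andP[_ /eqP ei] /andP[_ /eqP ej]]|->].
    have es : s = z 0 0 + r * z 0 1 by rewrite /s -ej -ei; field.
    have es' : s' = z 0 0 - r * z 0 1.
      by rewrite /s' -ei Qf es mulrC mulKf // -es.
    by apply: vec2P; rewrite !(vec2_0, vec2_1) es es'; field; rewrite ?r0 two0.
  set w := vec2 _ _.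
  have e1 : w 0 0 + r * w 0 1 = s.
    by rewrite !(vec2_0, vec2_1); field; rewrite r0 two0.
  have e2 : w 0 0 - r * w 0 1 = s'.
    by rewrite !(vec2_0, vec2_1); field; rewrite r0 two0.
  have ei : Q w = i by rewrite Qf e1 e2 /s'; field.
  rewrite ei e1 eqxx andbT; apply/and3P; split.
  - by apply: contraNneq s0 => w0; rewrite -e1 -w0 !mxE mulr0 addr0.
  - apply: contraNneq s0 => w0; rewrite -e1 w0 vec2_0 vec2_1.
    by rewrite -expr2 r2 subrr.
  - by apply/eqP; rewrite /s; field.
(* With [i = j] the first coordinate is zero, hence [Q z = 0], and a nonzero [i] leaves no [z]. *)
have [->|i0] := eqVneq i 0; last first.
  rewrite mulr0 addr0 subrr.
  suff -> : [set z | (dist 0 z == Some i) && (dist z (vec2 1 r) == Some i)] =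
      set0 by rewrite cards0.
  apply/setP => z; rewrite !inE !dist_eqSome sub0r QN Qy.
  apply/negP => /andP[/andP[_ /eqP ei] /andP[_ /eqP]]; rewrite ei => /eqP.
  rewrite -subr_eq0 addrAC subrr sub0r oppr_eq0 mulf_eq0 (negPf two0) /=.
  move=> /eqP e.
  by case/eqP: i0; rewrite -ei Qf e mul0r.
rewrite !mulr1.
(* The solutions fill the isotropic line through [0] and [vec2 1 r] except these two points, at
   [a = 0] and [a = 1]; hence [q - 2]. *)
pose f (a : F) := a *: vec2 1 r.
have fi : injective f.
  by move=> a b /rowP/(_ 0); rewrite /f !mxE /= !mulr1.
have -> : [set z | (dist 0 z == Some 0) && (dist z (vec2 1 r) == Some 0)] =
    f @: (~: [set 0; 1]).
  have f0 : f 0 = 0 by rewrite /f scale0r.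
  have f1 : f 1 = vec2 1 r by rewrite /f scale1r.
  apply/setP => z; rewrite !inE !dist_eqSome sub0r QN Qy.
  apply/idP/imsetP => [/andP[/andP[z0 /eqP ei] /andP[zy /eqP]]|[a]].
    rewrite ei sub0r => /eqP; rewrite oppr_eq0 mulf_eq0 (negPf two0) addr_eq0.
    move=> /= /eqP e; have ez : z = f (z 0 0).
      apply: vec2P; rewrite /f !mxE /= ?mulr1 // e.
      by rewrite mulNr mulrAC -expr2 r2 mulN1r opprK.
    exists (z 0 0) => //; rewrite !inE negb_or.
    by rewrite -!(inj_eq fi) -ez f0 f1 eq_sym z0.
  rewrite !inE negb_or => /andP[a0 a1] ->.
  have e : f a 0 0 + r * f a 0 1 = 0.
    transitivity (a * (1 + r ^+ 2)); first by rewrite !mxE /=; ring.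
    by rewrite r2 subrr mulr0.
  rewrite Qf e mul0r mulr0 subr0 eqxx !andbT -f0 -f1 !(inj_eq fi) eq_sym.
  by rewrite a0.
rewrite (card_imset _ fi) cardsCs setCK cards2 eq_sym oner_eq0.
by rewrite -subzn ?finNzRing_gt1 // addrAC subrr add0r.
Qed.

(** * Collinearity *)

Lemma collinear_cross x y z : x != y ->
  collinear x y z <-> cross (x - y) (x - z) = 0.
Proof.
move=> nxy; split.
  case=> p [v [_ /subsetP s]].
  have on w : w \in [set x; y; z] -> exists t, w = p + t *: v.
    by move=> /s /imsetP[t _ ->]; exists t.
  have [|a ->] := on x; first by rewrite !inE eqxx.
  have [|b ->] := on y; first by rewrite !inE eqxx orbT.
  have [|c ->] := on z; first by rewrite !inE eqxx !orbT.
  by rewrite /cross !mxE; ring.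
move=> e; exists x, (x - y); split; first by rewrite subr_eq0.
(* The scalar is a quotient taken in a coordinate where [x - y] is nonzero; the zero determinant
   settles the other coordinate. *)
have [t et] : exists t, x - z = t *: (x - y).
  have [u0|u0] := eqVneq ((x - y) 0 0) 0.
    have u1 : (x - y) 0 1 != 0.
      apply: contra_neq nxy => u1; apply/eqP; rewrite -subr_eq0; apply/eqP.
      by apply: vec2P; rewrite ?u0 ?u1 mxE.
    exists ((x - z) 0 1 / (x - y) 0 1).
    move/eqP: e; rewrite /cross u0 mul0r sub0r oppr_eq0 mulf_eq0 (negPf u1).
    move=> /= /eqP w0.
    by apply: vec2P; rewrite [RHS]mxE ?w0 ?u0 ?mulr0 // divfK.
  exists ((x - z) 0 0 / (x - y) 0 0).
  apply: vec2P; rewrite [RHS]mxE ?divfK //.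
  by apply: (mulfI u0); move/subr0_eq: e => ->; field.
apply/subsetP => w; rewrite !inE -orbA => /or3P[]/eqP ->; apply/imsetP.
- by exists 0; rewrite ?scale0r ?addr0.
- by exists (-1); rewrite // scaleN1r subKr.
- by exists (- t); rewrite // scaleNr -et subKr.
Qed.

(** * Values of [Q] and intersection numbers *)

Lemma card_squares : odd #|F| -> (#|F| < 2 * #|[set t ^+ 2 | t : F]|)%N.
Proof.
move=> oddF; set A := [set _ | _ : F].
rewrite ltn_neqAle; apply/andP; split.
  by apply/negP => /eqP e; move: oddF; rewrite e oddM.
(* [g] chooses a square root of each square, so that [F] is covered by the two
   sets [g @: A] and [- g @: A]. *)
pose g a : F := odflt 0 [pick t | t ^+ 2 == a].
have gK t : g (t ^+ 2) ^+ 2 = t ^+ 2.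
  by rewrite /g; case: pickP => [s /eqP//|/(_ t)]; rewrite eqxx.
have -> : #|F| = #|(g @: A) :|: (fun a => - g a) @: A|.
  rewrite -cardsT; apply: eq_card => t; rewrite !inE; apply/esym.
  have tA : t ^+ 2 \in A by apply: imset_f.
  have /eqP := gK t; rewrite eqf_sqr => /orP[]/eqP e; apply/orP.
    by left; apply/imsetP; exists (t ^+ 2).
  by right; apply/imsetP; exists (t ^+ 2); rewrite // e opprK.
apply: leq_trans (leq_card_setU _ _) _.
by rewrite mul2n -addnn leq_add ?leq_imset_card.
Qed.

(** Pigeonhole: the squares and their reflections [k - a] each fill more than half of [F], so they
    meet. This provides a pair at every nonzero distance, so that [intersection_number] does not
    take its dummy value there. *)
Lemma Q_surj k : odd #|F| -> exists v, Q v = k.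
Proof.
move=> oddF; set A := [set t ^+ 2 | t : F]; pose B := [set k - a | a in A].
have cB : #|B| = #|A|.
  by apply: card_imset => a b /addrI /oppr_inj.
have : A :&: B != set0.
  apply: contraTneq (card_squares oddF) => AB; rewrite -leqNgt mul2n -addnn.
  by rewrite -{2}cB -cardsUI AB cards0 addn0 max_card.
case/set0Pn => w /setIP[/imsetP[a _ ->] /imsetP[_ /imsetP[b _ ->] e]].
by exists (vec2 a b); rewrite /Q vec2_0 vec2_1 e subrK.
Qed.

Lemma intersection_number_neq0 i j k : odd #|F| -> k != 0 ->
  [set i; j] != [set 0; k] ->
  (intersection_number (Some i) (Some j) (Some k))%:Z =
  quad_char (heron i j k) + 1.
Proof.
move=> oddF k0 nd; have [v ev] := Q_surj k oddF.
have -> : Some k = dist v 0.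
  apply/esym/eqP; rewrite dist_eqSome subr0 ev eqxx andbT.
  by apply: contra_neq k0 => v0; rewrite -ev v0 Q0.
by rewrite intersection_numberE // pair_number_neq0 // subr0 ev.
Qed.

Lemma collinear_heron x y z i j k : odd #|F| -> triple_distances x y z i j k ->
  collinear x y z <-> heron i j k = 0.
Proof.
move=> oddF [/eqP + /eqP + /eqP]; rewrite !dist_eqSome.
move=> /andP[_ /eqP <-] /andP[_ /eqP <-] /andP[nxy /eqP <-].
rewrite heron_cross collinear_cross //; split=> [->|/eqP].
  by rewrite mulr0 expr0n.
by rewrite sqrf_eq0 mulf_eq0 (negPf (two_neq0 oddF)) => /eqP.
Qed.

End PlanarTriples.

Theorem theorem8p1 (F : finFieldType) (oddF : odd #|F|) (i j k : F)
    (Di : Some i \in Delta F) (Dj : Some j \in Delta F)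
    (Dk : Some k \in Delta F) :
  let q := #|F| in
  let sigma1 := i + j + k in
  let sigma2 := i * j + j * k + k * i in
  [/\ (q %% 4 = 1)%N ->
        (intersection_number (Some i) (Some j) (Some 0))%:Z =
        1 + (q%:Z - 2) * (i == j)%:Z * (i == 0)%:Z - (i == j)%:Z,
      (q %% 4 <> 1)%N ->
        k != 0 /\
        (intersection_number (Some i) (Some j) (Some k))%:Z =
        quad_char (4 * sigma2 - sigma1 ^+ 2) + 1,
      (q %% 4 = 1)%N -> k != 0 -> [set i; j] != [set 0; k] ->
        (intersection_number (Some i) (Some j) (Some k))%:Z =
        quad_char (4 * sigma2 - sigma1 ^+ 2) + 1
    & (exists x y z : 'rV[F]_2, triple_distances x y z i j k) ->
        (4 * sigma2 = sigma1 ^+ 2 <->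
         exists x y z : 'rV[F]_2,
           triple_distances x y z i j k /\ collinear x y z)].
Proof.
have DeltaP a : (#|F| %% 4 <> 1)%N -> Some a \in Delta F -> a != 0.
  by move=> /eqP/negPf q1; rewrite /Delta q1 !inE.
move=> q sigma1 sigma2; split.
- move=> q1; have [r r2] := @sqrtN1_exists F q1.
  rewrite -(pair_number_eq0 i j oddF r2) -intersection_numberE //.
  congr (intersection_number _ _ _)%:Z; apply/esym/eqP.
  rewrite dist_eqSome sub0r QN /Q vec2_0 vec2_1 r2 expr1n subrr eqxx andbT.
  by apply/eqP => /rowP/(_ 0)/eqP; rewrite !mxE /= eq_sym oner_eq0.
- move=> q1; have k0 := DeltaP k q1 Dk; split=> //.
  (* Here [Delta F] omits [Some 0], so [i] and [j] are nonzero and [0] separates the two sets. *)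
  apply: intersection_number_neq0 => //; apply/eqP => /setP/(_ 0).
  rewrite !inE eqxx /= ![0 == _]eq_sym.
  by rewrite (negPf (DeltaP i q1 Di)) (negPf (DeltaP j q1 Dj)).
- by move=> _ k0 nd; apply: intersection_number_neq0.
(* Heron's form depends on the distances alone, so one triple with these distances decides
   collinearity for all of them. *)
move=> [x [y [z T]]]; split=> [e|].
  exists x, y, z; split=> //; apply/(collinear_heron oddF T).
  by rewrite /heron -/sigma1 -/sigma2 e subrr.
by case=> x' [y' [z' [T' /(collinear_heron oddF T')]]] /subr0_eq.
Qed.
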